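(* Let $s\ge 2$, $\mu=2$, $n=2s-1$, and let $\omega\in\mathbb R$. The overdetermined moment system $$\sum_{k=1}^m Z_k z_k^l=\sigma_{1-n+l},\qquad l=0,1,\dots,2n-1,$$ with right-hand sides $\sigma_0=\omega$, $\sigma_{2}=\sigma_{-2}=1$, $\sigma_k=0$ for $k\ne 0,\pm 2$, is solvable for some $m<n$ with all $Z_k\in\mathbb C$ nonzero and all $z_k\in\mathbb C$ pairwise distinct with $|z_k|=1$ if and only if $r_s(\omega)=0$ (that is, $\omega\in\Omega_s$). In this case $m=n-1$, and the solution $\{z_k\}$ consists of the roots of the polynomial $z\mapsto\mathcal R_{s-1}(\omega;z^2)$.
   Context: The polynomials $r_k(\omega)$ are defined by $r_{-1}=0$, $r_0=1$, $r_k(\omega)+\omega r_{k-1}(\omega)+r_{k-2}(\omega)=0$ for $k\ge1$ (so $r_k(\omega)=(-1)^kU_k(\omega/2)$ with $U_k$ the Chebyshev polynomial of the second kind). For $s\ge 1$, $$\mathcal R_{s-1}(\omega;t)=r_0(\omega)+r_1(\omega)t+\dots+r_{s-1}(\omega)t^{s-1},\qquad \Omega_s=\left\{2\cos\frac{\pi\alpha}{s+1}:\ \alpha=1,\dots,s\right\};$$ $\Omega_s$ is the set of roots of $r_s$. The system has unknowns $Z_k,z_k$. Note that $\sigma_{-2}$ is among the right-hand sides only if $2\le n-1$, which holds here. *)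

(* Defs.v *)
From mathcomp Require Import all_boot all_order all_algebra.
From mathcomp Require Import all_classical all_reals all_analysis.
From mathcomp Require Import complex.

Set Implicit Arguments.
Unset Strict Implicit.
Unset Printing Implicit Defensive.

Import Order.TTheory GRing.Theory Num.Theory.

Local Open Scope classical_set_scope.
Local Open Scope ring_scope.
Local Open Scope complex_scope.

(* The index is shifted by one: [rpoly_shift k] is r_{k-1}, so that the
   sequence can start at r_{-1} = 0. *)
Fixpoint rpoly_shift (R : realType) (k : nat) : {poly R} :=
  match k with
  | 0 => 0
  | 1 => 1
  | (k'.+1 as k1).+1 => - ('X * rpoly_shift R k1) - rpoly_shift R k'
  end.

Definition rpoly (R : realType) (k : nat) : {poly R} := rpoly_shift R k.+1.

Lemma rpoly_rec (R : realType) (k : nat) :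
  rpoly_shift R k.+2 + 'X * rpoly_shift R k.+1 + rpoly_shift R k = 0.
Proof. by rewrite /= addrAC subrK addNr. Qed.

(* As a polynomial in t, for fixed omega; the degree bound d is s - 1. *)
Definition calR (R : realType) (d : nat) (omega : R) : {poly R} :=
  \sum_(j < d.+1) (rpoly R j).[omega] *: 'X^j.

Definition Omega (R : realType) (s : nat) : set R :=
  [set 2 * cos (pi * alpha%:R / s.+1%:R)
     | alpha in [set a : nat | (1 <= a <= s)%N]].

Definition sigma (R : realType) (omega : R) (k : int) : R[i] :=
  if k == 0 then omega%:C
  else if (k == 2) || (k == - 2) then 1 else 0.

(* The index 1 - n + l of sigma is an integer, not a truncated difference. *)
Definition unimodular_moment_solution (R : realType) (n : nat)
    (sig : int -> R[i]) (m : nat) (Z z : 'I_m -> R[i]) : Prop :=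
  [/\ forall k, Z k != 0,
      injective z,
      forall k, `|z k| = 1
    & forall l : nat, (l <= 2 * n - 1)%N ->
        \sum_(k < m) Z k * z k ^+ l = sig (1 - n%:Z + l%:Z)].

(* Main.v *)
Require Import Defs.
From mathcomp Require Import all_boot all_order all_algebra all_field.
From mathcomp Require Import all_classical all_reals all_analysis.
From mathcomp Require Import complex zify ring.

(** Write [A = 1 + omega X^2 + X^4] for the symbol of the right-hand sides and
[Q(z) = R_{s-1}(omega; z^2)].  Because only [sigma_0], [sigma_2] and
[sigma_{-2}] are nonzero, the sum [sum_j p_j sigma_{j-e+2}] is the coefficient
of [X^e] in [A p], for every polynomial [p] ([sum_sigma_coef]); and the
recurrence of the [r_k] says that
[A Q = 1 - r_s X^(2s) + r_{s-1} X^(2s+2)] ([symbol_nodepoly]).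

Given a solution with [m < n], let [P] be the product of the [X - z_k].  The
moments satisfy the linear recurrence with characteristic polynomial [P], so
the coefficients of [A P] of index [1, ..., n+1] vanish, and so does the one of
index [0] when [m <= n - 2].  The latter would give [P(0) = 0], which is
impossible for unimodular nodes, whence [m = n - 1].  Now [A P] and [P(0) A Q]
have the same coefficients below [X^n], and [P], [Q] have degree less than [n];
as [A(0) = 1], this forces [P = P(0) Q].  The coefficient of index
[n + 1 = 2s] of [A P] is then [- P(0) r_s], so [r_s = 0]
([solution_polynomial]).

Conversely, if [r_s = 0] then [r_{s-1}^2 = 1], because
[r_k^2 + omega r_k r_{k-1} + r_{k-1}^2] is constantly [1].  So
[A Q = 1 + eps X^(2s+2)] with [eps = 1] or [eps = -1], a separable polynomial
with unimodular roots, and [Q], of degree [n - 1], has [n - 1] distinct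
unimodular roots.  A Vandermonde system gives weights matching the first
[n - 1] moments; the recurrence defined by [Q], which the right-hand sides
satisfy, propagates the match to all [2n] moments ([moment_extend]).  Nodes of
weight zero are discarded, which can only decrease [m].

That [Omega s] is the root set of [r_s] follows from
[r_k(2 cos t) sin t = (-1)^k sin((k+1)t)] and a count of roots. *)

Set Implicit Arguments.
Unset Strict Implicit.
Unset Printing Implicit Defensive.

Import Order.TTheory GRing.Theory Num.Theory.

Local Open Scope classical_set_scope.
Local Open Scope ring_scope.
Local Open Scope complex_scope.

(** * The symbol of the right-hand sides *)

(** The polynomial [1 + c X^2 + X^4]: the generating polynomial of
[sigma_{-2}, ..., sigma_2] when [sigma_0 = c]. *)
Definition symbol (F : nzRingType) (c : F) : {poly F} := 1 + c *: 'X^2 + 'X^4.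

Lemma coef_symbol (F : nzRingType) (c : F) (k : nat) :
  (symbol c)`_k = (k == 0%N)%:R + c * (k == 2)%:R + (k == 4)%:R.
Proof. by rewrite /symbol !coefD coefZ coef1 !coefXn. Qed.

Lemma coef_symbol_sigma (R : realType) (omega : R) (j e : nat) :
  sigma omega (j%:Z - e%:Z + 2) =
    if (j <= e)%N then (symbol omega%:C)`_(e - j) else 0.
Proof.
rewrite coef_symbol /sigma.
have -> : (j%:Z - e%:Z + 2 == 0) = (e == j + 2)%N by apply/eqP/eqP; lia.
have -> : (j%:Z - e%:Z + 2 == 2) = (e == j)%N by apply/eqP/eqP; lia.
have -> : (j%:Z - e%:Z + 2 == -2) = (e == j + 4)%N by apply/eqP/eqP; lia.
case: leqP => je; last first.
  have -> : (e == j + 2)%N = false by lia.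
  have -> : (e == j)%N = false by lia.
  by have -> : (e == j + 4)%N = false by lia.
have -> : (e - j == 0)%N = (e == j)%N by lia.
have -> : (e - j == 2)%N = (e == j + 2)%N by lia.
have -> : (e - j == 4)%N = (e == j + 4)%N by lia.
case: eqP => [->|_].
  have -> : (j + 2 == j)%N = false by lia.
  have -> : (j + 2 == j + 4)%N = false by lia.
  by rewrite /= mulr1 add0r addr0.
case: eqP => [->|_] /=; last by case: ifP => _; rewrite mulr0 !add0r.
have -> : (j == j + 4)%N = false by lia.
by rewrite mulr0 !addr0.
Qed.

(** Pairing a polynomial with the shifted right-hand sides extracts a
coefficient of its product with the symbol. *)
Lemma sum_sigma_coef (R : realType) (omega : R) (p : {poly R[i]}) (N e : nat) :
  (size p <= N)%N ->
  \sum_(j < N) p`_j * sigma omega (j%:Z - e%:Z + 2) =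
    (symbol omega%:C * p)`_e.
Proof.
move=> sp.
pose G j := p`_j * sigma omega (j%:Z - e%:Z + 2).
rewrite coefMr -[LHS]/(\sum_(j < N) G j).
rewrite (big_ord_widen _ G (leq_addl e.+1 N)).
rewrite (big_ord_widen _ (fun j => (symbol omega%:C)`_(e - j) * p`_j)
  (leq_addr N e.+1)).
rewrite big_mkcond [RHS]big_mkcond /=; apply: eq_bigr => j _.
rewrite /G coef_symbol_sigma ltnS.
case: (ltnP j N) => jN; case: (leqP j e) => je; rewrite ?mulr0.
- by rewrite mulrC.
- by [].
- by rewrite (nth_default 0 (leq_trans sp jN)) mulr0.
- by [].
Qed.

(** Multiplication by a polynomial with nonzero constant term is injective
modulo [X^N]. *)
Lemma coef_mul_eq0 (F : idomainType) (a p : {poly F}) (N : nat) :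
  a`_0 != 0 -> (size p <= N)%N -> (forall e, (e < N)%N -> (a * p)`_e = 0) ->
  p = 0.
Proof.
move=> a0 sp ap0; apply/polyP => i; rewrite coef0.
have [Ni|iN] := leqP N i; first by rewrite nth_default // (leq_trans sp).
elim/ltn_ind: i iN => i IH iN.
have := ap0 i iN; rewrite coefM big_ord_recl subn0 big1 => [|j _]; last first.
  by rewrite IH ?mulr0 //= /bump; have := ltn_ord j; lia.
by rewrite addr0 => /eqP; rewrite mulf_eq0 (negPf a0) => /eqP.
Qed.

(** * Exponential sums and linear recurrences *)

(** The moments [l |-> sum_k Z_k z_k^l] satisfy the linear recurrence whose
characteristic polynomial is any [p] vanishing at all the nodes. *)
Lemma moment_annihilate (F : comNzRingType) (m N : nat) (Z z : 'I_m -> F)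
    (p : {poly F}) (l : nat) :
  (size p <= N)%N -> (forall k, root p (z k)) ->
  \sum_(j < N) p`_j * (\sum_(k < m) Z k * z k ^+ (l + j)) = 0.
Proof.
move=> sp pz; under eq_bigr do rewrite mulr_sumr.
rewrite exchange_big /= big1 // => k _.
rewrite (eq_bigr (fun j : 'I_N => Z k * z k ^+ l * (p`_j * z k ^+ j))); last first.
  by move=> j _; rewrite exprD; ring.
by rewrite -mulr_sumr -(horner_coef_wide _ sp) (eqP (pz k)) mulr0.
Qed.

(** Distinct nodes interpolate any [d] first moments. *)
Lemma vandermonde_solve (F : fieldType) (d : nat) (z : 'I_d -> F) (t : nat -> F) :
  injective z ->
  exists Z : 'I_d -> F, forall l, (l < d)%N -> \sum_(k < d) Z k * z k ^+ l = t l.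
Proof.
move=> zinj; pose V := Vandermonde d (\row_k z k).
have Vu : V \in unitmx.
  rewrite unitmxE det_Vandermonde unitfE; apply/prodf_neq0 => i _.
  apply/prodf_neq0 => j ij; rewrite !mxE subr_eq0; apply: contraTneq ij.
  by move=> /zinj ->; rewrite ltnn.
pose T : 'cV[F]_d := \col_i t i.
exists (fun k => (invmx V *m T) k 0) => l ld.
have /(congr1 (fun M : 'cV[F]_d => M (Ordinal ld) 0)) := mulKVmx Vu T.
rewrite !mxE /= => <-; apply: eq_bigr => k _.
by rewrite !mxE mulrC.
Qed.

(** If [t] satisfies, up to index [L + d], the recurrence whose characteristic
polynomial has the [d] distinct nodes [z] as roots, then [t] is a combination of
their powers up to that index. *)
Lemma moment_extend (F : fieldType) (d L : nat) (z : 'I_d -> F) (t : nat -> F)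
    (p : {poly F}) :
  injective z -> size p = d.+1 -> (forall k, root p (z k)) ->
  (forall l, (l <= L)%N -> \sum_(j < d.+1) p`_j * t (l + j)%N = 0) ->
  exists Z : 'I_d -> F,
    forall l, (l <= L + d)%N -> \sum_(k < d) Z k * z k ^+ l = t l.
Proof.
move=> zinj sp pz pt; have [Z HZ] := vandermonde_solve t zinj.
exists Z; elim/ltn_ind => l IH lL.
have [|dl] := ltnP l d; first exact: HZ.
have lead0 : p`_d != 0.
  have := lead_coef_eq0 p; rewrite lead_coefE sp /= => ->.
  by rewrite -size_poly_eq0 sp.
have pt0 : \sum_(j < d.+1) p`_j * t (l - d + j)%N = 0 by apply: pt; lia.
have := etrans (moment_annihilate Z (l - d) (eq_leq sp) pz) (esym pt0).
rewrite !big_ord_recr /= subnK //.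
have -> : \sum_(j < d) p`_j * (\sum_(k < d) Z k * z k ^+ (l - d + j)) =
    \sum_(j < d) p`_j * t (l - d + j)%N.
  by apply: eq_bigr => j _; rewrite IH //; have := ltn_ord j; lia.
by move/addrI/(mulfI lead0).
Qed.

(** * The polynomials r_k and the node polynomial *)

Lemma rpoly_horner_rec (R : realType) (omega : R) (k : nat) :
  (rpoly R k.+2).[omega] =
    - (omega * (rpoly R k.+1).[omega]) - (rpoly R k).[omega].
Proof. by rewrite /rpoly /= !hornerE. Qed.

Lemma rpoly0 (R : realType) (omega : R) : (rpoly R 0).[omega] = 1.
Proof. by rewrite /rpoly /= hornerE. Qed.

Lemma rpoly1 (R : realType) (omega : R) : (rpoly R 1).[omega] = - omega.
Proof. by rewrite /rpoly /= mulr1 subr0 hornerN hornerX. Qed.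

(** The recurrence of the [r_k], in generating-function form: all the
intermediate coefficients cancel. *)
Lemma calR_mul (R : realType) (omega : R) (d : nat) :
  (1 + omega *: 'X + 'X^2) * calR d omega =
    1 - (rpoly R d.+1).[omega] *: 'X^(d.+1) + (rpoly R d).[omega] *: 'X^(d.+2).
Proof.
elim: d => [|d IH].
  rewrite /calR big_ord_recl big_ord0 rpoly0 rpoly1 expr0 expr1 !scale1r addr0.
  by rewrite mulr1 scaleNr opprK.
rewrite /calR big_ord_recr /= mulrDr -/(calR d omega) IH rpoly_horner_rec.
by rewrite -!mul_polyC !rmorphB !rmorphN /= !rmorphM /= !exprS; ring.
Qed.

(** The quadratic invariant of the recurrence. *)
Lemma rpoly_invariant (R : realType) (omega : R) (k : nat) :
  (rpoly R k.+1).[omega] ^+ 2 +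
    omega * (rpoly R k.+1).[omega] * (rpoly R k).[omega] +
    (rpoly R k).[omega] ^+ 2 = 1.
Proof.
elim: k => [|k IH]; first by rewrite rpoly0 rpoly1; ring.
by rewrite -[RHS]IH rpoly_horner_rec; ring.
Qed.

(** The polynomial [z |-> R_{s-1}(omega; z^2)] with complex coefficients; when
[r_s(omega) = 0], its roots are the nodes of every solution with fewer than [n]
nodes. *)
Definition nodepoly (R : realType) (s : nat) (omega : R) : {poly R[i]} :=
  map_poly (real_complex R) (calR s.-1 omega \Po 'X^2).

Lemma symbol_nodepoly (R : realType) (s : nat) (omega : R) : (0 < s)%N ->
  symbol omega%:C * nodepoly s omega =
    1 - ((rpoly R s).[omega])%:C *: 'X^(2 * s)
      + ((rpoly R s.-1).[omega])%:C *: 'X^(2 * s + 2).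
Proof.
case: s => // s _; rewrite /nodepoly /=.
have -> : symbol omega%:C =
    map_poly (real_complex R) ((1 + omega *: 'X + 'X^2) \Po 'X^2).
  rewrite !comp_polyD comp_polyC comp_polyZ rmorphXn /= comp_polyX.
  by rewrite !rmorphD /= rmorph1 map_polyZ !rmorphXn /= map_polyX -exprM.
rewrite -rmorphM -rmorphM /= calR_mul.
rewrite !comp_polyD comp_polyC -scaleNr !comp_polyZ !rmorphXn /= comp_polyX.
rewrite !rmorphD /= rmorph1 !map_polyZ !rmorphXn /= map_polyX -!exprM.
by rewrite rmorphN scaleNr /= -[(s.+2)%N]addn1 mulnDr.
Qed.

Lemma size_calR (R : realType) (d : nat) (omega : R) :
  (size (calR d omega) <= d.+1)%N.
Proof.
by rewrite /calR -(poly_def d.+1 (fun j => (rpoly R j).[omega])) size_poly.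
Qed.

Lemma size_nodepoly (R : realType) (s : nat) (omega : R) : (0 < s)%N ->
  (size (nodepoly s omega) <= 2 * s - 1)%N.
Proof.
case: s => // s _; rewrite /nodepoly size_map_poly /=.
apply: (leq_trans (size_comp_poly_leq _ _)).
by rewrite size_polyXn; have := size_calR s omega; lia.
Qed.

Lemma rpoly_pred_sqr (R : realType) (s : nat) (omega : R) : (0 < s)%N ->
  (rpoly R s).[omega] = 0 -> (rpoly R s.-1).[omega] ^+ 2 = 1.
Proof.
case: s => // s _ rs0; have := rpoly_invariant omega s.
by rewrite rs0 expr0n /= mulr0 mul0r !add0r.
Qed.

Lemma symbol_nodepoly_root (R : realType) (s : nat) (omega : R) : (0 < s)%N ->
  (rpoly R s).[omega] = 0 ->
  exists2 eps : R[i], eps ^+ 2 = 1 &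
    symbol omega%:C * nodepoly s omega = 1 + eps *: 'X^(2 * s + 2).
Proof.
move=> s0 rs0; exists ((rpoly R s.-1).[omega])%:C.
  by rewrite -rmorphXn /= rpoly_pred_sqr // rmorph1.
by rewrite symbol_nodepoly // rs0 rmorph0 scale0r subr0.
Qed.

(** No hypothesis on [c]: for [c = 0] the polynomial is the constant [1]. *)
Lemma separable_1DcXn (F : numFieldType) (c : F) (N : nat) : (0 < N)%N ->
  separable_poly (1 + c *: 'X^N).
Proof.
(* Bezout relation: f - (X / N) f' = 1 for f = 1 + c X^N *)
case: N => // N _; rewrite separable_poly.unlock; apply/Bezout_eq1_coprimepP.
exists (1, - (N.+1%:R^-1 *: 'X)) => /=.
rewrite derivD derivZ derivXn -polyC1 derivC add0r mul1r -scaler_nat /=.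
rewrite mulNr -scalerAl -!scalerAr -exprS !scalerA.
by rewrite mulrCA mulVf ?pnatr_eq0 // mulr1 addrK.
Qed.

Lemma separable_nodepoly (R : realType) (s : nat) (omega : R) : (0 < s)%N ->
  (rpoly R s).[omega] = 0 -> separable_poly (nodepoly s omega).
Proof.
move=> s0 rs0; have [eps _ E] := symbol_nodepoly_root s0 rs0.
apply: (@dvdp_separable _ (1 + eps *: 'X^(2 * s + 2))); last first.
  by apply: separable_1DcXn; rewrite addn2.
by rewrite -E dvdp_mull.
Qed.

Lemma norm_root_nodepoly (R : realType) (s : nat) (omega : R) (z : R[i]) :
  (0 < s)%N -> (rpoly R s).[omega] = 0 -> root (nodepoly s omega) z ->
  `|z| = 1.
Proof.
move=> s0 rs0 /rootP Qz; have [eps eps2 E] := symbol_nodepoly_root s0 rs0.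
have := congr1 (horner^~ z) E.
rewrite hornerM Qz mulr0 hornerD hornerZ hornerXn hornerC => /esym/eqP.
rewrite addrC addr_eq0 => /eqP/(congr1 (fun x => `|x|)).
rewrite normrN normr1 normrM normrX.
have -> : `|eps| = 1.
  by apply/eqP; rewrite -(@pexpr_eq1 _ _ 2) // -normrX eps2 normr1.
rewrite mul1r => /eqP; rewrite pexpr_eq1 // ?addn2 //.
by move/eqP.
Qed.

Lemma size_nodepoly_root (R : realType) (s : nat) (omega : R) : (0 < s)%N ->
  (rpoly R s).[omega] = 0 -> size (nodepoly s omega) = (2 * s - 1)%N.
Proof.
move=> s0 rs0; have [eps eps2 E] := symbol_nodepoly_root s0 rs0.
apply/eqP; rewrite eqn_leq size_nodepoly //= leqNgt; apply/negP => lt.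
have sA : (size (symbol omega%:C) <= 5)%N.
  apply/leq_sizeP => j j5; rewrite coef_symbol.
  have [-> -> ->] : [/\ (j == 0)%N = false, (j == 2)%N = false & (j == 4)%N = false].
    by split; lia.
  by rewrite mulr0 !addr0.
have /leq_sizeP/(_ (2 * s + 2)%N (leqnn _)) :
    (size (symbol omega%:C * nodepoly s omega)%R <= 2 * s + 2)%N.
  apply: (leq_trans (size_polyMleq _ _)); rewrite -subn1 leq_subLR.
  rewrite -ltnS; apply: (@leq_trans (5 + (2 * s - 1))); last by lia.
  by rewrite -addnS leq_add.
rewrite E coefD coefZ coefXn eqxx mulr1 coef1 addn2 /= add0r => eps0.
by move/eqP: eps2; rewrite eps0 expr0n eq_sym oner_eq0.
Qed.

(** * Solutions of the moment system *)

(** Necessity and uniqueness: a solution with fewer than [n] nodes has exactly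
[n - 1] of them, they are the roots of the node polynomial, and [r_s(omega)]
vanishes. *)
Lemma solution_polynomial (R : realType) (s n m : nat) (omega : R)
    (Z z : 'I_m -> R[i]) :
  (0 < s)%N -> n = (2 * s - 1)%N -> (m < n)%N ->
  unimodular_moment_solution n (sigma omega) Z z ->
  [/\ m = n.-1, (rpoly R s).[omega] = 0
    & exists2 c : R[i], c != 0 &
        \prod_(k < m) ('X - (z k)%:P) = c *: nodepoly s omega].
Proof.
move=> s0 hn mn [_ _ z1 mom].
set P := \prod_(k < m) ('X - (z k)%:P); set Q := nodepoly s omega.
have sP : size P = m.+1 by rewrite /P -big_enum /= size_prod_XsubC size_enum_ord.
have rootP k : root P (z k).
  by rewrite /root horner_prod (bigD1 k) //= hornerXsubC subrr mul0r.
have P0 : P`_0 != 0.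
  rewrite -horner_coef0 horner_prod; apply/prodf_neq0 => k _.
  rewrite hornerXsubC sub0r oppr_eq0 -normr_eq0 z1; exact: oner_neq0.
have AP e : (e <= n.+1)%N -> (m + 2 <= n + e)%N ->
    (symbol omega%:C * P)`_e = 0.
  move=> en me; rewrite -(@sum_sigma_coef _ _ _ m.+1) ?sP //.
  rewrite -[RHS](moment_annihilate Z (n.+1 - e) (eq_leq sP) rootP).
  apply: eq_bigr => j _; congr (_ * _); rewrite mom; last first.
    by have := ltn_ord j; lia.
  by congr sigma; lia.
(* For m <= n - 2 the range of AP includes e = 0, so that P(0) = 0. *)
have mE : m = n.-1.
  apply/eqP; rewrite eqn_leq; apply/andP; split; first by lia.
  rewrite leqNgt; apply/negP => lt; have := AP 0%N; rewrite coef0M.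
  move=> /(_ (leq0n _)) H; have {H}/eqP : (symbol omega%:C)`_0 * P`_0 = 0.
    by apply: H; lia.
  by rewrite mulf_eq0 (negPf P0) orbF coef_symbol /= mulr0 !addr0 oner_eq0.
(* A * (P - P(0) Q) vanishes below X^n, and P - P(0) Q has degree < n. *)
have PQ : P = P`_0 *: Q.
  apply/eqP; rewrite -subr_eq0; apply/eqP.
  apply: (@coef_mul_eq0 _ (symbol omega%:C) _ n).
  - by rewrite coef_symbol /= mulr0 !addr0 oner_eq0.
  - rewrite (leq_trans (size_polyD _ _)) // size_polyN geq_max sP mn /=.
    by rewrite (leq_trans (size_scale_leq _ _)) // hn size_nodepoly.
  move=> e en; rewrite mulrBr coefB -scalerAr coefZ symbol_nodepoly //.
  rewrite !coefD coefN !coefZ !coefXn coef1.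
  have [-> ->] : (e == 2 * s)%N = false /\ (e == 2 * s + 2)%N = false by lia.
  rewrite !mulr0 oppr0 !addr0; case: (posnP e) => [->|e0].
    by rewrite coef0M coef_symbol /= mulr0 !addr0 mul1r mulr1 subrr.
  by rewrite mulr0 subr0 AP //; move: e0 en mE mn hn s0; lia.
split=> //; last by exists P`_0.
(* 2s = n + 1 is the last index at which the moment equations apply. *)
have : (symbol omega%:C * P)`_(2 * s) = 0 by apply: AP; lia.
rewrite PQ -scalerAr coefZ symbol_nodepoly //.
rewrite !coefD coefN !coefZ !coefXn coef1 eqxx.
have [-> ->] : (2 * s == 0)%N = false /\ (2 * s == 2 * s + 2)%N = false by lia.
rewrite mulr1 mulr0 add0r addr0 => /eqP.
rewrite mulf_eq0 (negPf P0) oppr_eq0 /= => /eqP.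
by move=> /(congr1 (@complex.Re R)).
Qed.

(** The nodes of zero weight can be removed without changing the moments. *)
Lemma drop_zero_weights (R : realType) (n m : nat) (sig : int -> R[i])
    (Z z : 'I_m -> R[i]) :
  injective z -> (forall k, `|z k| = 1) ->
  (forall l : nat, (l <= 2 * n - 1)%N ->
     \sum_(k < m) Z k * z k ^+ l = sig (1 - n%:Z + l%:Z)) ->
  exists2 m', (m' <= m)%N &
    exists Z' z' : 'I_m' -> R[i], unimodular_moment_solution n sig Z' z'.
Proof.
move=> zinj z1 mom; pose S := [pred k | Z k != 0].
exists #|S|; first by rewrite -[leqRHS]card_ord max_card.
exists (fun k => Z (enum_val k)), (fun k => z (enum_val k)); split.
- by move=> k; have := enum_valP k; rewrite inE.
- by move=> i j /zinj/enum_val_inj.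
- by move=> k; exact: z1.
move=> l ll; rewrite -mom // -(big_enum_val (A := S) (fun k => Z k * z k ^+ l)).
rewrite big_mkcond; apply: eq_bigr => k _ /=.
by rewrite inE; case: eqP => //= ->; rewrite mul0r.
Qed.

Lemma solution_exists (R : realType) (s n : nat) (omega : R) :
  (0 < s)%N -> n = (2 * s - 1)%N -> (rpoly R s).[omega] = 0 ->
  exists m : nat, (m < n)%N /\ exists Z z : 'I_m -> R[i],
    unimodular_moment_solution n (sigma omega) Z z.
Proof.
move=> s0 hn rs0; set Q := nodepoly s omega.
have sQ : size Q = n.-1.+1 by rewrite size_nodepoly_root // hn; lia.
have Q0 : lead_coef Q != 0 by rewrite lead_coef_eq0 -size_poly_eq0 sQ.
have [r Qr] := closed_field_poly_normal Q.
have sr : size r = n.-1.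
  by move: sQ; rewrite Qr size_scale // size_prod_XsubC => -[].
have ur : uniq r.
  rewrite -separable_prod_XsubC -(eqp_separable (eqp_scale _ Q0)) -Qr.
  exact: separable_nodepoly.
have rr x : x \in r -> root Q x by rewrite Qr rootZ // root_prod_XsubC.
pose z (k : 'I_n.-1) := r`_k.
have zr k : z k \in r by rewrite mem_nth // sr.
have zinj : injective z.
  by move=> i j /eqP; rewrite nth_uniq ?sr // => /eqP/val_inj.
have AQ l : (l <= n)%N ->
    \sum_(j < n.-1.+1) Q`_j * sigma omega (1 - n%:Z + (l + j)%:Z) = 0.
  move=> ln; have E := @sum_sigma_coef _ omega Q n.-1.+1 (n.+1 - l) (eq_leq sQ).
  have [eps _ AQE] := symbol_nodepoly_root s0 rs0.
  transitivity ((symbol omega%:C * Q)`_(n.+1 - l)).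
    rewrite -E; apply: eq_bigr => j _; congr (_ * sigma _ _); lia.
  rewrite AQE coefD coefZ coefXn coef1.
  have [-> ->] : (n.+1 - l == 0)%N = false /\ (n.+1 - l == 2 * s + 2)%N = false.
    by lia.
  by rewrite mulr0 addr0.
have [Z HZ] := @moment_extend _ _ n z (fun l => sigma omega (1 - n%:Z + l%:Z)) Q
  zinj sQ (fun k => rr _ (zr k)) AQ.
have [||l ll|m' m'n sol] := @drop_zero_weights _ n _ (sigma omega) Z z.
- exact: zinj.
- by move=> k; apply: (norm_root_nodepoly s0 rs0); apply/rr/zr.
- by apply: HZ; lia.
by exists m'; split=> //; lia.
Qed.

(** * The roots of r_s *)

(** [r_k(2 cos t) = (-1)^k U_k(cos t)], in trigonometric form. *)
Lemma rpoly_cos (R : realType) (t : R) (k : nat) :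
  (rpoly R k).[2 * cos t] * sin t = (-1) ^+ k * sin (k.+1%:R * t).
Proof.
elim/ltn_ind: k => -[|[|k]] IH.
- by rewrite rpoly0 mul1r expr0 !mul1r.
- rewrite rpoly1 expr1 (_ : 2%:R * t = t + t) ?sinD; ring.
rewrite rpoly_horner_rec mulrBl mulNr -[_ * _ * sin t]mulrA !IH //.
have -> : k.+1%:R * t = k.+2%:R * t - t by rewrite -[k.+2%:R]natr1; ring.
have -> : k.+3%:R * t = k.+2%:R * t + t by rewrite -[k.+3%:R]natr1; ring.
by rewrite sinB sinD !exprS; ring.
Qed.

Lemma size_rpoly (R : realType) (k : nat) : size (rpoly R k) = k.+1.
Proof.
elim/ltn_ind: k => -[|[|k]] IH.
- by rewrite size_poly1.
- by rewrite /rpoly /= mulr1 subr0 size_polyN size_polyX.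
have -> : rpoly R k.+2 = - ('X * rpoly R k.+1) - rpoly R k by [].
have sX : size ('X * rpoly R k.+1) = k.+3.
  by rewrite mulrC size_mulX ?IH // -size_poly_eq0 IH.
by rewrite size_polyDl !size_polyN sX // IH.
Qed.

Lemma Omega_angle (R : realType) (s a : nat) : (1 <= a <= s)%N ->
  0 < @pi R * a%:R / s.+1%:R < @pi R.
Proof.
move=> /andP[a1 als]; apply/andP; split.
  by rewrite divr_gt0 ?mulr_gt0 ?pi_gt0 ?ltr0n.
by rewrite ltr_pdivrMr ?ltr0n // ltr_pM2l ?pi_gt0 // ltr_nat ltnS.
Qed.

Lemma sin_natpi (R : realType) (a : nat) : sin (@pi R * a%:R) = 0.
Proof.
elim: a => [|a IH]; first by rewrite mulr0 sin0.
by rewrite -natr1 mulrDr mulr1 sinDpi IH oppr0.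
Qed.

Lemma Omega_root (R : realType) (s : nat) (omega : R) :
  Omega s omega -> (rpoly R s).[omega] = 0.
Proof.
move=> [a /= ha <-]; set t := pi * _ / _.
have /lt0r_neq0 st : 0 < sin t by exact/sin_gt0_pi/Omega_angle.
apply: (mulIf st); rewrite rpoly_cos mul0r /t [X in sin X]mulrC.
by rewrite divfK ?pnatr_eq0 // sin_natpi mulr0.
Qed.

Lemma Omega_rpoly (R : realType) (s : nat) (omega : R) :
  (rpoly R s).[omega] = 0 <-> Omega s omega.
Proof.
split; last exact: Omega_root.
move=> rs0; apply: contrapT => nO.
pose f (a : nat) : R := 2 * cos (pi * a%:R / s.+1%:R).
have fO a : a \in iota 1 s -> Omega s (f a).
  by rewrite mem_iota => ha; exists a => //=; lia.
have finj : {in iota 1 s &, injective f}.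
  move=> a b; rewrite !mem_iota => ha hb.
  have n2 : (2 : R) != 0 by rewrite pnatr_eq0.
  have itv c : (1 <= c < 1 + s)%N -> pi * c%:R / s.+1%:R \in `[0, pi : R].
    rewrite add1n ltnS => /(Omega_angle R)/andP[t0 tpi].
    by rewrite in_itv /= !ltW.
  move=> /(mulfI n2)/cos_inj => /(_ (itv _ ha) (itv _ hb)).
  move/mulIf; rewrite invr_eq0 pnatr_eq0 => /(_ isT)/(mulfI (lt0r_neq0 (pi_gt0 R))).
  by move/eqP; rewrite eqr_nat => /eqP.
(* If omega is none of the s points f a, they give together s + 1 distinct
   roots of r_s, a nonzero polynomial of size s + 1. *)
have := @max_poly_roots _ (rpoly R s) (omega :: map f (iota 1 s)).
rewrite size_rpoly /= size_map size_iota ltnn -size_poly_eq0 size_rpoly.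
move=> many; suff : false by [].
apply: many => //.
  rewrite /root rs0 eqxx /=; apply/allP => _ /mapP[a ha ->].
  by apply/rootP/Omega_root/fO.
rewrite map_inj_in_uniq // iota_uniq andbT.
by apply/negP => /mapP[a ha E]; apply: nO; rewrite E; apply: fO.
Qed.

Theorem theorem6 (R : realType) (s n : nat) (omega : R)
    (hs : (2 <= s)%N) (hn : n = (2 * s - 1)%N) :
  [/\ (exists m : nat, (m < n)%N /\
         exists Z z : 'I_m -> R[i],
           unimodular_moment_solution n (sigma omega) Z z)
        <-> (rpoly R s).[omega] = 0,
      (rpoly R s).[omega] = 0 <-> Omega s omega
    & (rpoly R s).[omega] = 0 ->
        forall (m : nat) (Z z : 'I_m -> R[i]), (m < n)%N ->
          unimodular_moment_solution n (sigma omega) Z z ->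
          m = (n - 1)%N /\
          range z = [set x | root (map_poly (real_complex R)
                                     (calR s.-1 omega \Po 'X^2)) x]].
Proof.
have s0 : (0 < s)%N by exact: ltnW.
split; last 2 first.
- exact: Omega_rpoly.
- move=> _ m Z z mn sol.
  have [mE _ [c c0 PQ]] := solution_polynomial s0 hn mn sol.
  split; first by rewrite mE subn1.
  apply/seteqP; split=> x /=; rewrite -/(nodepoly s omega) -(rootZ _ _ c0) -PQ.
    move=> [k _ <-]; rewrite /root horner_prod (bigD1 k) //=.
    by rewrite hornerXsubC subrr mul0r.
  rewrite /root horner_prod prodf_seq_eq0 => /hasP[k _ /=].
  by rewrite hornerXsubC subr_eq0 => /eqP ->; exists k.
split; last exact: solution_exists.
by move=> [m [mn [Z [z sol]]]]; case: (solution_polynomial s0 hn mn sol).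
Qed.
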